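(* Let $\beta>0$, $N\ge1$. For $u\in H_0^1(\mathbb R_+)$ let $\widehat{\Pi}_{N, \beta}^{1,0} u\in\widehat P^0_{N,\beta}$ be defined by $$\bigl((u-\widehat{\Pi}_{N, \beta}^{1,0} u)', v'\bigr)+\frac{\beta^2}{4}\bigl(u-\widehat{\Pi}_{N, \beta}^{1,0} u , v\bigr)=0\qquad \forall v \in \widehat{P}_{N, \beta}^0.$$ Then for every $u\in H_0^1(\mathbb R_+)$, $$\bigl\|u-\widehat{\Pi}_{N, \beta}^{1,0} u\bigr\|_1 \le\Bigl(2+\frac{2}{\beta}\Bigr)\bigl\|u'-\widehat{\Pi}_{N-1}^\beta u'\bigr\|+(\beta+1)\bigl\|u-\widehat{\Pi}_{N-1}^\beta u\bigr\|.$$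
   Context: $(f,g)=\int_0^\infty f g\,dx$ and $\|\cdot\|$ is the $L^2(\mathbb R_+)$ norm; $\|\cdot\|_1$ is the $H^1(\mathbb R_+)$ norm; $H^1_0(\mathbb R_+)=\{u\in H^1(\mathbb R_+):u(0)=0\}$. $P_N$ is the space of polynomials of degree at most $N$, $\widehat P_N^{\beta,L}=\{e^{-\beta x/2}p(x):p\in P_N\}$, and $\widehat P^0_{N,\beta}=\{\phi\in\widehat P_N^{\beta,L}:\phi(0)=0\}$. $\widehat\Pi_{K}^\beta$ denotes the $L^2(\mathbb R_+)$-orthogonal projection onto $\widehat P_K^{\beta,L}$. *)

(* Defs.v *)
From HB Require Import structures.
From mathcomp Require Import all_boot all_order all_algebra.
From mathcomp Require Import all_classical all_reals all_analysis.
Set Implicit Arguments. Unset Strict Implicit. Unset Printing Implicit Defensive.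
Import Order.TTheory GRing.Theory Num.Theory.
Import numFieldNormedType.Exports.
Local Open Scope classical_set_scope.
Local Open Scope ring_scope.

Section Defs.
Variable R : realType.
Notation mu := (@lebesgue_measure R).

Definition Rplus_set : set R := `[0%R, +oo[%classic.

Definition L2 (f : R -> R) : Prop :=
  measurable_fun Rplus_set f /\
  mu.-integrable Rplus_set (fun x => ((f x) ^+ 2)%:E).

Definition ip (f g : R -> R) : R :=
  Rintegral mu Rplus_set (fun x => f x * g x).

Definition L2norm (f : R -> R) : R := Num.sqrt (ip f f).

(* u in H^1(R_+) with (weak) derivative du: u, du in L^2(R_+) and u is the
   absolutely continuous function u(x) = u(0) + \int_0^x du. *)
Definition H1 (u du : R -> R) : Prop :=
  L2 u /\ L2 du /\
  forall x, 0 <= x -> u x = u 0 + Rintegral mu `[0%R, x]%classic du.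

Definition H10 (u du : R -> R) : Prop := H1 u du /\ u 0 = 0.

Definition H1norm (v dv : R -> R) : R :=
  Num.sqrt (ip v v + ip dv dv).

(* Laguerre-type function e^{-beta x/2} p(x) and its derivative *)
Definition lagf (beta : R) (p : {poly R}) : R -> R :=
  fun x => expR (- (beta * x) / 2) * p.[x].
Definition lagd (beta : R) (p : {poly R}) : R -> R :=
  fun x => expR (- (beta * x) / 2) * ((p^`()).[x] - beta / 2 * p.[x]).

Definition inPN (K : nat) (p : {poly R}) : Prop := (size p <= K.+1)%N.

Definition is_L2proj (beta : R) (K : nat) (f : R -> R) (q : {poly R}) : Prop :=
  inPN K q /\
  forall r : {poly R}, inPN K r -> ip (fun x => f x - lagf beta q x) (lagf beta r) = 0.

Definition is_H10proj (beta : R) (N : nat) (u du : R -> R) (p : {poly R}) : Prop :=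
  inPN N p /\ p.[0] = 0 /\
  forall q : {poly R}, inPN N q -> q.[0] = 0 ->
    ip (fun x => du x - lagd beta p x) (lagd beta q)
    + beta ^+ 2 / 4 * ip (fun x => u x - lagf beta p x) (lagf beta q) = 0.

End Defs.

(* Main.v *)
Require Import Defs.
From HB Require Import structures.
From mathcomp Require Import all_boot all_order all_algebra.
From mathcomp Require Import all_classical all_reals all_analysis.
From mathcomp Require Import measurable_realfun.
From mathcomp Require Import ring lra.
Import Order.TTheory GRing.Theory Num.Theory.
Import numFieldNormedType.Exports.
Local Open Scope classical_set_scope.
Local Open Scope ring_scope.

(** Put T v = v' + (beta/2) v. If v(0) = 0 then (v, v') = lim v(M)^2/2 >= 0, so
    the energy a(v,v) = |v'|^2 + (beta^2/4) |v|^2 is at most |T v|^2.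
    Since T (e^{-beta x/2} w) = e^{-beta x/2} w', there is a w with w(0) = 0 and
    T (e^{-beta x/2} w) equal to the sum of the projection of u' and beta/2 times
    that of u.  The energy projection minimises a(u - v, u - v), so comparing it
    with this w bounds the energy of the error by the square of
    |u' - Pi u'| + (beta/2) |u - Pi u|. *)

(** * The inner product on $L^2(\mathbb R_+)$: bilinearity, Cauchy-Schwarz, triangle inequality *)

Section L2Rplus.
Local Set Implicit Arguments.
Local Unset Strict Implicit.
Context {R : realType}.
Notation mu := (@lebesgue_measure R).
Notation D := (@Rplus_set R).
Implicit Types (f g h : R -> R) (t : R).

Lemma measurable_Rplus : measurable D.
Proof. exact: measurable_itv. Qed.
Hint Resolve measurable_Rplus : core.

(** Domination: $|fg| \le f^2+g^2$. *)
Lemma L2_integrableM f g : L2 f -> L2 g ->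
  mu.-integrable D (EFin \o (fun x => f x * g x)).
Proof.
move=> [mf f2] [mg g2].
apply: (@le_integrable _ _ _ mu D _ _
  (EFin \o (fun x => f x ^+ 2 + g x ^+ 2))) => //.
- by apply/measurable_EFinP; exact: measurable_funM.
- move=> x _ /=; rewrite lee_fin (ger0_norm (addr_ge0 _ _)) ?sqr_ge0//.
  by rewrite ler_norml; apply/andP; split; nra.
- exact: (@integrableD _ _ _ mu D _
    (fun x => (f x ^+ 2)%:E) (fun x => (g x ^+ 2)%:E)).
Qed.

Lemma integrable_scaleM f g t : L2 f -> L2 g ->
  mu.-integrable D (EFin \o (fun x => t * (f x * g x))).
Proof.
move=> Lf Lg.
have := @integrableZl _ _ _ mu _ measurable_Rplus t _ (L2_integrableM Lf Lg).
by apply: eq_integrable => // x _; rewrite /= EFinM.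
Qed.

Lemma eq_L2 f g : (forall x, f x = g x) -> L2 f -> L2 g.
Proof. by move=> /funext ->. Qed.

(** The shape [f x + t * g x] covers differences ([t = -1]), the twist ([t = beta / 2]) and the
    quadratic in [t] behind Cauchy-Schwarz. *)
Lemma L2D f g t : L2 f -> L2 g -> L2 (fun x => f x + t * g x).
Proof.
move=> Lf Lg; have [mf f2] := Lf; have [mg g2] := Lg; split.
  by apply: measurable_funD => //; exact: measurable_funM.
pose k1 x := 2 * t * (f x * g x); pose k2 x := t ^+ 2 * (g x * g x).
have -> : (fun x => ((f x + t * g x) ^+ 2)%:E) =
    (EFin \o (fun x => f x * f x)) \+ ((EFin \o k1) \+ (EFin \o k2))%E.
  by apply/funext => x /=; rewrite -!EFinD /k1 /k2; congr EFin; ring.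
have I1 := @integrableD _ _ _ mu _ measurable_Rplus _ _
  (integrable_scaleM (2 * t) Lf Lg) (integrable_scaleM (t ^+ 2) Lg Lg).
exact: (@integrableD _ _ _ mu _ measurable_Rplus _ _ (L2_integrableM Lf Lf) I1).
Qed.

Lemma ipC f g : ip f g = ip g f.
Proof. by apply: eq_Rintegral => x _; rewrite mulrC. Qed.

Lemma eq_ip f1 f2 g1 g2 : (forall x, f1 x = f2 x) -> (forall x, g1 x = g2 x) ->
  ip f1 g1 = ip f2 g2.
Proof. by move=> /funext -> /funext ->. Qed.

Lemma ipDl f g h t : L2 f -> L2 g -> L2 h ->
  ip (fun x => f x + t * g x) h = ip f h + t * ip g h.
Proof.
move=> Lf Lg Lh; rewrite /ip.
under eq_Rintegral do rewrite mulrDl -mulrA.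
rewrite RintegralD// ?RintegralZl//; try exact: L2_integrableM.
exact: integrable_scaleM.
Qed.

Lemma ip_sqrD f g t : L2 f -> L2 g ->
  ip (fun x => f x + t * g x) (fun x => f x + t * g x) =
  ip f f + 2 * t * ip f g + t ^+ 2 * ip g g.
Proof.
move=> Lf Lg; have Lfg := L2D t Lf Lg.
rewrite ipDl// !(ipC _ (fun x => f x + t * g x)) !ipDl// (ipC g f); ring.
Qed.

Lemma ip_ge0 f : 0 <= ip f f.
Proof. by apply: Rintegral_ge0 => x _; exact: sqr_ge0. Qed.

Lemma L2norm_ge0 f : 0 <= L2norm f.
Proof. exact: sqrtr_ge0. Qed.

Lemma sqr_L2norm f : L2norm f ^+ 2 = ip f f.
Proof. by rewrite sqr_sqrtr// ip_ge0. Qed.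

(** The quadratic $t \mapsto \|f+tg\|^2$ is nonnegative; evaluating it at one well-chosen [t] gives
    the bound. *)
Lemma ip_le_L2norm f g : L2 f -> L2 g -> ip f g <= L2norm f * L2norm g.
Proof.
move=> Lf Lg.
have [a0 c0] := (L2norm_ge0 f, L2norm_ge0 g).
have P t : 0 <= L2norm f ^+ 2 + 2 * t * ip f g + t ^+ 2 * L2norm g ^+ 2.
  by rewrite !sqr_L2norm -ip_sqrD// ip_ge0.
move: (L2norm f) (L2norm g) (ip f g) a0 c0 P => a c b a0 c0 P.
have [c_eq|c_neq] := eqVneq c 0.
  rewrite c_eq in P *; rewrite mulr0 leNgt; apply/negP => b0.
  (* With [c = 0] the quadratic is affine in [t] with slope [2 * b > 0]; this [t] gives it the
     negative value $-a^2-2$. *)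
  have := P (- (a ^+ 2 + 1) / b).
  rewrite (_ : _ + _ = - a ^+ 2 - 2); last by field; lra.
  by nra.
have cp : 0 < c by rewrite lt_neqAle eq_sym c_neq.
apply: le_trans (ler_norm _) _; rewrite -(ler_pXn2r (_ : 0 < 2)%N) ?nnegrE ?mulr_ge0//.
rewrite -normrX ger0_norm ?sqr_ge0//.
(* The minimiser of the quadratic. *)
have := P (- b / c ^+ 2).
rewrite (_ : _ + _ = ((a * c) ^+ 2 - b ^+ 2) / c ^+ 2); last by field; lra.
by rewrite pmulr_lge0 ?invr_gt0 ?exprn_gt0// subr_ge0.
Qed.

Lemma L2norm_triangle f g t : 0 <= t -> L2 f -> L2 g ->
  L2norm (fun x => f x + t * g x) <= L2norm f + t * L2norm g.
Proof.
move=> t0 Lf Lg; have H := ip_le_L2norm Lf Lg.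
have [a0 c0] := (L2norm_ge0 f, L2norm_ge0 g).
rewrite -(ler_pXn2r (_ : 0 < 2)%N) ?nnegrE ?addr_ge0 ?mulr_ge0 ?L2norm_ge0//.
rewrite sqr_L2norm ip_sqrD// -!sqr_L2norm.
have := ler_wpM2l t0 H; nra.
Qed.
End L2Rplus.

(** * Laguerre functions: boundedness, differentiability, square integrability *)

Section Laguerre.
Local Set Implicit Arguments.
Local Unset Strict Implicit.
Context {R : realType}.
Notation mu := (@lebesgue_measure R).
Notation D := (@Rplus_set R).
Implicit Types (c x : R) (p : {poly R}).

(** The derivative is again a Laguerre function, so every property of [lagf] passes to [lagd]. *)
Lemma lagdE c p : lagd c p = lagf c (p^`() - (c / 2) *: p).
Proof.
by apply/funext => x; rewrite /lagd /lagf hornerD hornerN hornerZ.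
Qed.

(** One term of the exponential series gives $y^n \le n!\,e^y$ for $y \ge 0$; take $y = cx/2$. *)
Lemma expRN_mulXn_bounded c n : 0 < c ->
  exists C : R, forall x, 0 <= x -> `|expR (- (c * x) / 2) * x ^+ n| <= C.
Proof.
move=> c0; exists (n`!%:R / (c / 2) ^+ n) => x x0.
have y0 : 0 <= c * x / 2 by rewrite divr_ge0 ?mulr_ge0// ltW.
have H : (c * x / 2) ^+ n <= n`!%:R * expR (c * x / 2).
  rewrite -ler_pdivrMl ?ltr0n ?fact_gt0//.
  case: n => [|n]; last by apply: le_trans (expR_ge1Dxn n y0); rewrite mulrC lerDr.
  by rewrite expr0 fact0 invr1 mul1r; apply: le_trans (expR_ge1Dx _); rewrite lerDl.
rewrite ger0_norm ?mulr_ge0 ?expR_ge0 ?exprn_ge0// mulNr expRN.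
rewrite ler_pdivrMl ?expR_gt0// mulrA [expR _ * _]mulrC ler_pdivlMr ?exprn_gt0 ?divr_gt0//.
by rewrite -exprMn (_ : x * (c / 2) = c * x / 2)//; ring.
Qed.

Lemma lagf_bounded c p : 0 < c ->
  exists C : R, forall x, 0 <= x -> `|lagf c p x| <= C.
Proof.
(* The extra factor [x ^+ n] makes the induction work: in [p * 'X + a%:P] the factor ['X] is
   absorbed by raising [n]. *)
move=> c0; suff H n : exists C : R, forall x, 0 <= x ->
    `|expR (- (c * x) / 2) * x ^+ n * p.[x]| <= C.
  have [C HC] := H 0%N; exists C => x /HC; by rewrite expr0 mulr1.
elim/poly_ind: p n => [|p a IH] n.
  by exists 0 => x _; rewrite horner0 mulr0 normr0.
have [C1 H1] := IH n.+1; have [C2 H2] := expRN_mulXn_bounded n c0.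
exists (C1 + C2 * `|a|) => x x0; rewrite hornerMXaddC.
rewrite (_ : _ * _ = expR (- (c * x) / 2) * x ^+ n.+1 * p.[x] +
  expR (- (c * x) / 2) * x ^+ n * a); last by rewrite exprS; ring.
rewrite (le_trans (ler_normD _ _))// lerD ?H1// normrM ler_wpM2r//.
exact: H2.
Qed.

Lemma is_derive_lagf c p x : is_derive x 1 (lagf c p) (lagd c p x).
Proof.
have H1 : is_derive x 1 (fun y : R => - (c * y) / 2) (- (c / 2)).
  rewrite (_ : (fun y => _) = (- (c / 2)) \*: (@id R)); last first.
    by apply/funext => y /=; rewrite /GRing.scale /=; ring.
  by apply: is_derive_eq; rewrite /GRing.scale /= mulr1.
have H2 : is_derive x 1 (fun y : R => expR (- (c * y) / 2)) (expR (- (c * x) / 2) * - (c / 2)).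
  by apply: is_derive1_comp.
have H3 := is_derive_poly p x.
have H4 := is_deriveM H2 H3.
apply: is_derive_eq; rewrite /lagd /GRing.scale /=; ring.
Qed.

Lemma continuous_lagf c p : continuous (lagf c p).
Proof.
move=> x; apply: differentiable_continuous; apply/derivable1_diffP.
by have [] := is_derive_lagf c p x.
Qed.

Lemma measurable_lagf c p : measurable_fun setT (lagf c p).
Proof. by apply: continuous_measurable_fun; exact: continuous_lagf. Qed.

(** Half of the decay bounds the polynomial: [lagf c p] is the bounded [lagf (c / 2) p] times
    $e^{-cx/4}$. Its square is thus at most $C^2 e^{-cx/2}$, a multiple of the exponential density
    of rate [c / 2]. *)
Lemma L2_lagf c p : 0 < c -> L2 (lagf c p).
Proof.
move=> c0; split; first by apply: measurable_funTS; exact: measurable_lagf.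
have c20 : 0 < c / 2 by rewrite divr_gt0.
have [C HC] := lagf_bounded p c20.
have mR := @measurable_Rplus R.
have I0 : mu.-integrable D (EFin \o exponential_pdf (c / 2)).
  apply: (@integrableS _ _ _ mu setT) => //; exact: integrable_exponential_pdf.
have I1 := @integrableZl _ _ _ mu _ mR (C ^+ 2 / (c / 2)) _ I0.
apply: (@le_integrable _ _ _ mu D mR _ _ _ _ I1).
  apply/measurable_EFinP; apply: measurable_funX.
  by apply: measurable_funTS; exact: measurable_lagf.
move=> x; rewrite /Rplus_set /= in_itv /= andbT => x0.
rewrite lee_fin ger0_norm ?sqr_ge0// exponential_pdfE//.
rewrite (le_trans _ (ler_norm _))//.
rewrite (_ : lagf c p x = lagf (c / 2) p x * expR (- (c * x) / 4)); last first.
  by rewrite /lagf mulrAC -expRD; congr (expR _ * _); field.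
rewrite exprMn -expRM_natl (_ : 2%:R * _ = - (c / 2) * x); last by field.
rewrite mulrA divfK ?gt_eqF// ler_wpM2r ?expR_ge0//.
by have := HC _ x0; rewrite ler_norml => /andP[]; nra.
Qed.

Lemma lagf_Rintegral c p x : 0 <= x ->
  lagf c p x = lagf c p 0 + Rintegral mu `[0%R, x]%classic (lagd c p).
Proof.
rewrite le_eqVlt => /predU1P[<-|x0].
  by rewrite set_itv1 Rintegral_set1 addr0.
have cf := @continuous_lagf c p.
rewrite /Rintegral (@continuous_FTC2 _ (lagd c p) (lagf c p) 0 x)//=.
- by rewrite subrKC.
- by rewrite lagdE; apply: continuous_subspaceT; exact: continuous_lagf.
- split.
  + by move=> y _; have [] := is_derive_lagf c p y.
  + by apply: cvg_at_right_filter; exact: cf.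
  + by apply: cvg_at_left_filter; exact: cf.
- by move=> y _; rewrite derive1E; have [] := is_derive_lagf c p y.
Qed.
End Laguerre.

(** * The integral of an integrable function times its primitive, by Fubini *)

Section Primitive.
Local Set Implicit Arguments.
Local Unset Strict Implicit.
Context {R : realType}.
Notation mu := (@lebesgue_measure R).
Variable g : R -> R.
Hypothesis ig : mu.-integrable setT (EFin \o g).

Let G (x : R) : R := Rintegral mu `]-oo, x]%classic g.
Let H (x : R) : R := Rintegral mu `[x, +oo[%classic g.
Let c : R := Rintegral mu setT g.
Let k (z : R * R) : \bar R := (if z.2 <= z.1 then g z.1 * g z.2 else 0)%:E.

Let mg : measurable_fun setT g.
Proof. by apply/measurable_EFinP; exact: measurable_int ig. Qed.

Let mgg : measurable_fun setT (fun z : R * R => g z.1 * g z.2).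
Proof.
apply: measurable_funM.
- by apply: measurableT_comp => //; exact: measurable_fst.
- by apply: measurableT_comp => //; exact: measurable_snd.
Qed.

(** The kernel is dominated by $|g(x)g(y)|$, whose iterated integral is $a^2$ with
    $a=\int|g|<\infty$. *)
Let ik : (mu \x mu)%E.-integrable setT k.
Proof.
apply: (@le_integrable _ _ _ (mu \x mu)%E setT measurableT k
  (fun z : R * R => (g z.1 * g z.2)%:E)) => //.
- apply/measurable_EFinP; apply: measurable_fun_ifT => //.
  by apply: measurable_fun_ler; [exact: measurable_snd|exact: measurable_fst].
- move=> z _; rewrite lee_fin /=; case: ifP => // _.
  by rewrite normr0.
- apply/integrable12ltyP; first exact/measurable_EFinP.
  have /integrableP[_ A] := ig.
  set a := (\int[mu]_x `|(EFin \o g) x|)%E in A.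
  have a0 : (0 <= a)%E by exact: integral_ge0.
  have afin : a \is a fin_num by rewrite ge0_fin_numE.
  under eq_integral => x _.
    under eq_integral => y _.
      rewrite /= normrM EFinM; over.
    rewrite ge0_integralZl//; last first.
      by apply/measurable_EFinP; exact: measurableT_comp.
    rewrite -/a -(fineK afin) muleC; over.
  rewrite ge0_integralZl//; last 2 first.
    - by apply/measurable_EFinP; exact: measurableT_comp.
    - by rewrite fineK.
  by rewrite fineK// lte_mul_pinfty.
Qed.

(** The two half-lines share only the point [x], which has measure zero. *)
Let GH x : G x + H x = c.
Proof.
rewrite /c -set_itvNyy /G /H.
have ig' : mu.-integrable `]-oo, +oo[%classic (EFin \o g) by rewrite set_itvNyy.
rewrite -(@Rintegral_itv_obnd_cbnd _ x +oo%O).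
  by rewrite -(Rintegral_itvB (x := x) ig')// subrKC.
exact: integrableS ig.
Qed.

Let kF x : (\int[mu]_y k (x, y) = (g x * G x)%:E)%E.
Proof.
have igx : mu.-integrable `]-oo, x]%classic (EFin \o g) by exact: integrableS ig.
rewrite EFinM /G /Rintegral fineK; last exact: integrable_fin_num.
rewrite -integralZl//= [RHS]integral_mkcond; apply: eq_integral => y _.
rewrite patchE /k /=; case: ifPn => yx.
  by rewrite mem_set ?EFinM//= in_itv.
by rewrite memNset//= in_itv /=; exact/negP.
Qed.

Let kG y : (\int[mu]_x k (x, y) = (g y * H y)%:E)%E.
Proof.
have igx : mu.-integrable `[y, +oo[%classic (EFin \o g) by exact: integrableS ig.
rewrite EFinM /H /Rintegral fineK; last exact: integrable_fin_num.
rewrite -integralZl//= [RHS]integral_mkcond; apply: eq_integral => x _.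
rewrite patchE /k /=; case: ifPn => yx.
  by rewrite mem_set ?EFinM 1?muleC//= in_itv /= andbT.
by rewrite memNset//= in_itv /= andbT; exact/negP.
Qed.

Lemma integrable_mul_primitive : mu.-integrable setT (EFin \o (fun x => g x * G x)).
Proof.
have := integrable_fubini_F ik.
by apply: eq_integrable => // x _ /=; rewrite /fubini_F kF.
Qed.

(* By Fubini on the triangle {y <= x}, \int g G = \int g H, and G + H = c. *)
Lemma Rintegral_mul_primitive :
  Rintegral mu setT (fun x => g x * G x) = c ^+ 2 / 2.
Proof.
have := Fubini ik.
under eq_integral do rewrite kF.
under [in X in _ = X -> _]eq_integral do rewrite kG.
move=> /(congr1 fine); rewrite -/(Rintegral _ _ _) -[in X in _ = X]/(Rintegral _ _ _).
(* Substituting [H = c - G] turns the Fubini equality into $I = c^2 - I$ for $I=\int gG$. *)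
under [X in _ = X -> _]eq_Rintegral => x _.
  have -> : H x = c - G x by rewrite -(GH x) addrC addKr.
  rewrite mulrBr; over.
have igc : mu.-integrable setT (EFin \o (fun x => g x * c)).
  have := @integrableZr _ _ _ mu _ measurableT c _ ig.
  by apply: eq_integrable.
rewrite RintegralB//; last exact: integrable_mul_primitive.
rewrite RintegralZr// -/c => E; move: E; set I := Rintegral _ _ _; lra.
Qed.
End Primitive.

(** * Nonnegativity of $(e,e')$ on the half-line when $e(0)=0$ *)

Section HalfLine.
Local Set Implicit Arguments.
Local Unset Strict Implicit.
Context {R : realType}.
Notation mu := (@lebesgue_measure R).
Notation D := (@Rplus_set R).
Implicit Types f h e de : R -> R.

(** The integrals over $[0,n]$ converge to the integral over the half-line by dominated convergence,
    with dominating function $|h|$. *)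
Lemma Rintegral_Rplus_ge0 h : mu.-integrable D (EFin \o h) ->
  (forall M, 0 <= M -> 0 <= Rintegral mu `[0%R, M]%classic h) ->
  0 <= Rintegral mu D h.
Proof.
move=> ih h0; have mD := @measurable_Rplus R.
have mh := measurable_int _ ih.
pose h_ n : R -> \bar R := (EFin \o h) \_ `[0%R, n%:R]%classic.
have seg n : `[0%R, n%:R]%classic `<=` D.
  by move=> x; rewrite /Rplus_set /= !in_itv /= => /andP[->].
have [|||||_ _ C] := @dominated_convergence _ _ _ mu D mD h_ (EFin \o h) (abse \o (EFin \o h)).
- move=> n; apply/measurable_restrict => //.
  by apply: measurable_funS mh => // x [].
- exact: mh.
- apply: aeW => x; rewrite /Rplus_set /= in_itv /= andbT => x0.
  (* For fixed [x] the truncations equal [h x] as soon as [n >= x]. *)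
  apply: cvg_near_cst; near=> n.
  rewrite /h_ patchE mem_set//= in_itv /= x0 /=.
  by near: n; exact: nbhs_infty_ger.
- exact: integrable_abse.
- apply: aeW => x n _; rewrite /h_ patchE; case: ifP => //= _.
  by rewrite normr0 lee_fin.
apply: fine_ge0; rewrite -(cvg_lim _ C)//.
apply: lime_ge; first by apply/cvg_ex; eexists; exact: C.
apply: nearW => n; rewrite /= /h_ -integral_mkcondr setIidr//.
have ihn : mu.-integrable `[0%R, n%:R]%classic (EFin \o h).
  exact: integrableS ih.
by rewrite -(fineK (integrable_fin_num _ ihn))// lee_fin h0.
Unshelve. all: by end_near. Qed.

(** Domination: $|f| \le 1+f^2$, and constants are integrable on a segment. *)
Lemma L2_integrable_segment f M : L2 f -> mu.-integrable `[0%R, M]%classic (EFin \o f).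
Proof.
move=> [mf f2]; have mD := @measurable_Rplus R.
have seg : `[0%R, M]%classic `<=` D.
  by move=> x; rewrite /Rplus_set /= !in_itv /= => /andP[->].
have mS : measurable `[0%R, M]%classic by exact: measurable_itv.
have i1 : mu.-integrable `[0%R, M]%classic (EFin \o cst 1).
  apply: continuous_compact_integrable; first exact: segment_compact.
  by apply: continuous_subspaceT => x; exact: cvg_cst.
have i2 := @integrableS _ _ _ mu _ _ _ mD mS seg f2.
apply: (@le_integrable _ _ _ mu _ mS _ _ _ _ (@integrableD _ _ _ mu _ mS _ _ i1 i2)).
  by apply/measurable_EFinP; exact: measurable_funS mf.
move=> x _ /=; rewrite lee_fin [leRHS]ger0_norm ?addr_ge0 ?sqr_ge0//.
by rewrite ler_norml; apply/andP; split; nra.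
Qed.

(** This is $\int ee' = e(M)^2/2$ for [e] that is merely a primitive of an integrable [de], hence
    the detour through Fubini. Extended by zero outside the segment, [de] has a primitive on the
    line that agrees with [e] on $[0,M]$ and total integral [e M]. *)
Lemma Rintegral_segment_mul_deriv e de M : 0 <= M ->
  mu.-integrable `[0%R, M]%classic (EFin \o de) ->
  (forall x, 0 <= x -> e x = Rintegral mu `[0%R, x]%classic de) ->
  Rintegral mu `[0%R, M]%classic (fun x => e x * de x) = e M ^+ 2 / 2.
Proof.
move=> M0 ide eE.
pose g := de \_ `[0%R, M]%classic.
have ig : mu.-integrable setT (EFin \o g).
  by rewrite -restrict_EFin; apply/(integrable_mkcond _ _).1.
have := Rintegral_mul_primitive ig.
rewrite -(Rintegral_mkcond mu `[0%R, M]%classic de) -eE// => <-.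
rewrite Rintegral_mkcond; apply: eq_Rintegral => x _.
rewrite /g !patchE; case: ifPn => [|_]; last by rewrite mul0r.
rewrite inE /= in_itv /= => /andP[x0 xM]; rewrite mulrC eE//; congr (_ * _).
rewrite -/g /g -(Rintegral_mkcondr mu); congr (Rintegral _ _ _).
apply/seteqP; split => y /=; rewrite !in_itv /=.
  by move=> /andP[-> yx]; rewrite yx (le_trans yx).
by case=> -> /andP[->].
Qed.

Lemma ip_deriv_ge0 e de : L2 e -> L2 de ->
  (forall x, 0 <= x -> e x = Rintegral mu `[0%R, x]%classic de) ->
  0 <= ip e de.
Proof.
move=> Le Lde eE; apply: Rintegral_Rplus_ge0; first exact: L2_integrableM.
move=> M M0; rewrite Rintegral_segment_mul_deriv//.
  by rewrite divr_ge0 ?sqr_ge0.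
exact: L2_integrable_segment.
Qed.
End HalfLine.

Lemma poly_antideriv (F : numFieldType) (q : {poly F}) :
  exists w : {poly F}, [/\ (size w <= (size q).+1)%N, w.[0] = 0 & w^`() = q].
Proof.
exists (\poly_(i < (size q).+1) ((if i is j.+1 then q`_j else 0) / i%:R)); split.
- exact: size_poly.
- by rewrite horner_coef0 coef_poly /= mul0r.
- apply/polyP => i; rewrite coef_deriv coef_poly /= ltnS.
  case: ltnP => [_|iq]; last by rewrite mul0rn nth_default.
  by rewrite -[LHS]mulr_natr divfK// pnatr_eq0.
Qed.

(** * The energy form: bound by the twisted norm, and minimality of the projection *)

Section EnergyProjection.
Context {R : realType}.
Notation mu := (@lebesgue_measure R).
Local Set Implicit Arguments.
Local Unset Strict Implicit.
Implicit Types (e de u du : R -> R) (beta : R).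

(** Expanding the square gives the energy plus the cross term [beta * ip e de], which is nonnegative
    by [ip_deriv_ge0]. *)
Lemma energy_le_twist e de beta : 0 <= beta -> L2 e -> L2 de ->
  (forall x, 0 <= x -> e x = Rintegral mu `[0%R, x]%classic de) ->
  ip de de + beta ^+ 2 / 4 * ip e e <=
  L2norm (fun x => de x + beta / 2 * e x) ^+ 2.
Proof.
move=> b0 Le Lde eE; have P := ip_deriv_ge0 Le Lde eE.
rewrite sqr_L2norm ip_sqrD// (ipC de).
have : 0 <= beta * ip e de by rewrite mulr_ge0.
rewrite (_ : 2 * (beta / 2) = beta); last by field.
rewrite (_ : (beta / 2) ^+ 2 = beta ^+ 2 / 4); last by field.
lra.
Qed.

Lemma L2_sub_lagf beta p u : 0 < beta -> L2 u -> L2 (fun x => u x - lagf beta p x).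
Proof.
move=> b0 Lu; have := L2D (-1) Lu (L2_lagf p b0).
by apply: eq_L2 => x; rewrite mulN1r.
Qed.

Lemma L2_sub_lagd beta p u : 0 < beta -> L2 u -> L2 (fun x => u x - lagd beta p x).
Proof. by rewrite lagdE; exact: L2_sub_lagf. Qed.

(** Both terms vanish at 0, so the error has the primitive form that [energy_le_twist] asks for. *)
Lemma H10_sub_lagf beta u du (w : {poly R}) x : H10 u du -> w.[0] = 0 -> 0 <= x ->
  u x - lagf beta w x = Rintegral mu `[0%R, x]%classic (fun y => du y - lagd beta w y).
Proof.
move=> [[Lu [Ldu uE]] u0] w0 x0.
rewrite RintegralB//; last 2 first.
- exact: L2_integrable_segment.
- rewrite lagdE; apply: continuous_compact_integrable; first exact: segment_compact.
  by apply: continuous_subspaceT; exact: continuous_lagf.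
by rewrite uE// u0 add0r lagf_Rintegral// [lagf _ _ 0]/lagf w0 mulr0 add0r.
Qed.

(** Pythagoras: the error of [w] is the error of [p] plus [v = p - w], an admissible test function,
    so the cross terms cancel by orthogonality and the energy of [v] is nonnegative. *)
Lemma energy_H10proj_le beta N u du (p w : {poly R}) : 0 < beta ->
  L2 u -> L2 du -> is_H10proj beta N u du p -> inPN N w -> w.[0] = 0 ->
  ip (fun x => du x - lagd beta p x) (fun x => du x - lagd beta p x) +
  beta ^+ 2 / 4 * ip (fun x => u x - lagf beta p x) (fun x => u x - lagf beta p x)
  <=
  ip (fun x => du x - lagd beta w x) (fun x => du x - lagd beta w x) +
  beta ^+ 2 / 4 * ip (fun x => u x - lagf beta w x) (fun x => u x - lagf beta w x).
Proof.
move=> b0 Lu Ldu [pN [p0 orth]] wN w0; pose v := p - w.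
have vN : inPN N v.
  by rewrite /inPN (leq_trans (size_polyD _ _))// size_polyN geq_max pN.
have v0 : v.[0] = 0 by rewrite /v hornerD hornerN p0 w0 subrr.
have {orth} := orth v vN v0.
have LE := L2_sub_lagf p b0 Lu; have LdE := L2_sub_lagd p b0 Ldu.
have Lv := L2_lagf v b0.
have Ldv : L2 (lagd beta v) by rewrite lagdE; exact: L2_lagf.
have eE x : u x - lagf beta w x = (u x - lagf beta p x) + 1 * lagf beta v x.
  by rewrite /lagf /v hornerD hornerN; ring.
have deE x : du x - lagd beta w x = (du x - lagd beta p x) + 1 * lagd beta v x.
  by rewrite /lagd /v derivB !hornerD !hornerN; ring.
rewrite (eq_ip eE eE) (eq_ip deE deE) !ip_sqrD// expr1n !mul1r mulr1 => orth.
have k0 : 0 <= beta ^+ 2 / 4 by rewrite divr_ge0 ?sqr_ge0.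
have := mulr_ge0 k0 (ip_ge0 (lagf beta v)); have := ip_ge0 (lagd beta v).
move: (ip _ _) orth => a; move: (ip _ _) => b; lra.
Qed.

End EnergyProjection.

(** * Choice of the competitor and bookkeeping of the constants *)

Theorem mainTheorem14 (R : realType) (beta : R) (N : nat)
  (hbeta : 0 < beta) (hN : (1 <= N)%N)
  (u du : R -> R) (hu : H10 u du)
  (p : {poly R}) (hp : is_H10proj beta N u du p)
  (qu qd : {poly R})
  (hqu : is_L2proj beta N.-1 u qu) (hqd : is_L2proj beta N.-1 du qd) :
  H1norm (fun x => u x - lagf beta p x) (fun x => du x - lagd beta p x)
  <= (2 + 2 / beta) * L2norm (fun x => du x - lagf beta qd x)
     + (beta + 1) * L2norm (fun x => u x - lagf beta qu x).
Proof.
have [[Lu [Ldu _]] _] := hu.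
have [quN _] := hqu; have [qdN _] := hqd.
(* Both projections have degree at most [N.-1]; integrating raises this to at most [N], so [w]
   competes with [p]. *)
have [w [wN w0 dw]] := poly_antideriv _ (qd + (beta / 2) *: qu).
have {}wN : inPN N w.
  rewrite /inPN in quN qdN *; rewrite (leq_trans wN)// ltnS.
  rewrite (leq_trans (size_polyD _ _))// geq_max -(prednK hN) qdN /=.
  by rewrite (leq_trans (size_scale_leq _ _)).
have Lqu := L2_sub_lagf qu hbeta Lu; have Lqd := L2_sub_lagf qd hbeta Ldu.
have Le := L2_sub_lagf w hbeta Lu; have Lde := L2_sub_lagd w hbeta Ldu.
have eE x (x0 : 0 <= x) := H10_sub_lagf beta hu w0 x0.
(* The terms in [beta / 2 * w] cancel, leaving $e^{-\beta x/2}w'$, which splits into the two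
   projections. *)
have twist : (fun x => (du x - lagd beta w x) + beta / 2 * (u x - lagf beta w x)) =
    (fun x => (du x - lagf beta qd x) + beta / 2 * (u x - lagf beta qu x)).
  by apply/funext => x; rewrite /lagd /lagf dw hornerD hornerZ; ring.
have b2 : 0 <= beta / 2 by rewrite divr_ge0// ltW.
have := L2norm_triangle b2 Lqd Lqu.
have := energy_le_twist (ltW hbeta) Le Lde eE.
have := energy_H10proj_le hbeta Lu Ldu hp wN w0.
have := L2norm_ge0 (fun x => du x + - lagd beta w x + beta / 2 * (u x - lagf beta w x)).
rewrite twist /H1norm.
have := ip_ge0 (fun x => u x - lagf beta p x).
have := ip_ge0 (fun x => du x - lagd beta p x).
have := L2norm_ge0 (fun x => u x - lagf beta qu x).
have := L2norm_ge0 (fun x => du x - lagf beta qd x).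
set X := ip (fun x => u x - lagf beta p x) _; set Y := ip (fun x => du x - lagd beta p x) _.
set A := L2norm _; set B := L2norm _; set S := L2norm _.
move=> A0 B0 Y0 X0 S0 le1 le2 le3.
have XY : Y + beta ^+ 2 / 4 * X <= S ^+ 2 by exact: le_trans le1 le2.
have ib0 : 0 < 2 / beta by rewrite divr_gt0.
have k0 : 0 <= beta ^+ 2 / 4 * X by rewrite mulr_ge0 ?divr_ge0 ?sqr_ge0.
(* Each of the two nonnegative parts of the energy is at most [S ^+ 2]. *)
have Xle : X <= (2 / beta) ^+ 2 * S ^+ 2.
  rewrite (_ : X = (2 / beta) ^+ 2 * (beta ^+ 2 / 4 * X)); last by field; lra.
  by rewrite ler_wpM2l ?sqr_ge0//; lra.
have Yle : Y <= S ^+ 2 by lra.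
(* Uses $1+t^2 \le (1+t)^2$ with $t = 2/\beta$. *)
apply: (@le_trans _ _ ((1 + 2 / beta) * S)).
  rewrite -(@ger0_norm _ ((1 + 2 / beta) * S)) ?mulr_ge0 ?addr_ge0// ?(ltW ib0)//.
  rewrite -sqrtr_sqr ler_wsqrtr//; nra.
have : (1 + 2 / beta) * S <= (1 + 2 / beta) * (A + beta / 2 * B).
  by rewrite ler_wpM2l// addr_ge0// ltW.
(* These coefficients are below the stated ones by [1] and [beta / 2], and [A], [B] are
   nonnegative. *)
rewrite (_ : _ * (A + _) = (1 + 2 / beta) * A + (beta / 2 + 1) * B); last by field; lra.
have := mulr_ge0 (ltW hbeta) B0; nra.
Qed.
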